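(* Let $K$ be a convex compact subset of $[0,1]^\Gamma$ for some set $\Gamma$, let $L$ be a zero-dimensional compact space, and let $\mathcal{G}$ be a family of clopen subsets of $L$ which is isomorphic to a family of pseudoclopens of $K$. Then there is a countable decomposition $\mathcal{G}=\bigcup_{n<\omega}\mathcal{G}_n$ such that for every $x,y\in L$ and every $n<\omega$ there exists a further finite decomposition $\mathcal{G}_n=\bigcup_{m=0}^n\mathcal{G}_{nm}$ such that for every $m\le n$ and every partition $\mathcal{G}_{nm}=\mathcal{F}\cup\mathcal{H}$ (into disjoint, possibly empty, subfamilies), if $$\mathcal{F}\supset\{a\in\mathcal{G}_{nm}: x,y\in a\}\quad\text{and}\quad\mathcal{H}\supset\{a\in\mathcal{G}_{nm}: x,y\notin a\},$$ then $\bigcap\mathcal{F}\setminus\bigcup\mathcal{H}\neq\emptyset$. In particular, for every $m\le n$ the family $\mathcal{G}_{nm}(x,y)=\{a\in\mathcal{G}_{nm}: |a\cap\{x,y\}|=1\}$ is independent.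
   Context: All compact spaces are Hausdorff and nonempty; ''zero-dimensional'' means having a base of clopen sets. Decomposition pieces may be empty; $\bigcap\emptyset=L$. A family of sets in $L$ is independent if $\bigcap_{i\le p}a_i\setminus\bigcup_{j\le q}b_j\neq\emptyset$ for all distinct members $a_1,\ldots,a_p,b_1,\ldots,b_q$ of it. A pseudoclopen of a compact space $K$ is a pair $a=(a^-,a^+)$ with $a^-\subset K$ closed, $a^+\subset K$ open and $a^-\subset a^+$. For a family $\mathcal{G}$ of clopen subsets of $L$, a bijection $\phi$ from $\mathcal{G}$ onto a family of pseudoclopens of $K$ is an isomorphism if for all $n,m\ge 0$ and all distinct $a_1,\ldots,a_n,b_1,\ldots,b_m\in\mathcal{G}$: (1) if $\bigcap_{i\le n}a_i\setminus\bigcup_{j\le m}b_j=\emptyset$ then $\bigcap_{i\le n}\phi(a_i)^+\setminus\bigcup_{j\le m}\phi(b_j)^-=\emptyset$; (2) if $\bigcap_{i\le n}\phi(a_i)^-\setminus\bigcup_{j\le m}\phi(b_j)^+=\emptyset$ then $\bigcap_{i\le n}a_i\setminus\bigcup_{j\le m}b_j=\emptyset$. (Empty intersections are $L$, respectively $K$.)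
   Formalization: The final ''in particular'' clause on independence of G_nm(x,y) is stated only for x ≠ y; for x = y it fails literally, e.g. for G = {L} with L sent to (K,K), since {L} is not independent. The main clause is kept for all x, y. *)

(* Defs.v *)
From HB Require Import structures.
From mathcomp Require Import all_boot all_order all_algebra.
From mathcomp Require Import all_classical all_reals all_analysis.
Set Implicit Arguments.
Unset Strict Implicit.
Unset Printing Implicit Defensive.

Import Order.TTheory GRing.Theory Num.Theory numFieldNormedType.Exports.
Local Open Scope classical_set_scope.
Local Open Scope ring_scope.

(* When [s] is empty the intersection is the whole type [T]. *)
Definition meet_minus_join (I : eqType) (T : Type) (A B : I -> set T)
    (s t : seq I) : set T :=
  \bigcap_(i in [set` s]) A i `\` \bigcup_(j in [set` t]) B j.

Definition independent (T : Type) (F : set (set T)) : Prop :=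
  forall s t : seq (set T), uniq (s ++ t) -> [set` s ++ t] `<=` F ->
    meet_minus_join id id s t !=set0.

(* A pair (a^-, a^+). *)
Definition pseudoclopen (T : topologicalType) (a : set T * set T) : Prop :=
  [/\ closed a.1, open a.2 & a.1 `<=` a.2].

Definition pseudoclopen_iso (L : Type) (T : topologicalType)
    (G : set (set L)) (P : set (set T * set T))
    (phi : set L -> set T * set T) : Prop :=
  [/\ P `<=` @pseudoclopen T,
      set_bij G P phi,
      forall s t : seq (set L), uniq (s ++ t) -> [set` s ++ t] `<=` G ->
        meet_minus_join id id s t = set0 ->
        meet_minus_join (fun a => (phi a).2) (fun b => (phi b).1) s t = set0
    & forall s t : seq (set L), uniq (s ++ t) -> [set` s ++ t] `<=` G ->
        meet_minus_join (fun a => (phi a).1) (fun b => (phi b).2) s t = set0 ->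
        meet_minus_join id id s t = set0].

Definition pseudoclopen_isomorphic (L : Type) (T : topologicalType)
    (G : set (set L)) : Prop :=
  exists (P : set (set T * set T)) (phi : set L -> set T * set T),
    pseudoclopen_iso G P phi.

(* Main.v *)
(* A point x of L yields, by condition (2) and compactness of K, a point f_x
   lying in a^- for every a containing x and outside a^+ for every other a.
   Let G_n consist of the a whose a^+ contains the closed uniform
   (n+1)^-1-neighbourhood of a^-, and cut the segment from f_x to f_y into n+1
   steps of size at most (n+1)^-1. If a in G_n separates x from y, then among
   the division points some h_m with m <= n lies in a^+ minus a^-: take m where
   the segment crosses the boundary of a^-. A single point h_m then witnesses,
   by condition (1) and compactness of L, all the intersections required of
   G_nm. *)

Require Import Defs.
From HB Require Import structures.
From mathcomp Require Import all_boot all_order all_algebra.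
From mathcomp Require Import all_classical all_reals all_analysis.
From mathcomp Require Import ring lra.
Set Implicit Arguments.
Unset Strict Implicit.
Unset Printing Implicit Defensive.

Import Order.TTheory GRing.Theory Num.Theory numFieldNormedType.Exports.
Local Open Scope classical_set_scope.
Local Open Scope ring_scope.

(** * Finite intersection property *)

(** The finite intersections generate a proper filter, and any cluster point of it lies in every
    closed [A i] and avoids every open [B i]. It serves in [T], in [L], and for sequences of closed
    sets in the square of [K]. *)
Lemma compact_meet_minus_join (T : topologicalType) (I : eqType)
    (A B : I -> set T) (F H : set I) :
  compact [set: T] -> F `&` H = set0 ->
  (forall i, F i -> closed (A i)) -> (forall i, H i -> open (B i)) ->
  (forall s t : seq I, uniq (s ++ t) -> [set` s] `<=` F -> [set` t] `<=` H ->
    meet_minus_join A B s t !=set0) ->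
  (\bigcap_(i in F) A i) `\` (\bigcup_(i in H) B i) !=set0.
Proof.
move=> cT FH0 clA opB meet.
pose D := [set p : seq I * seq I | [/\ uniq (p.1 ++ p.2),
  [set` p.1] `<=` F & [set` p.2] `<=` H]].
pose E (p : seq I * seq I) := meet_minus_join A B p.1 p.2.
have ED : ProperFilter (filter_from D E).
  apply: filter_from_proper; last by case=> s t [] *; exact: meet.
  apply: filter_from_filter; first by exists ([::], [::]).
  move=> [s t] [s' t'] [/= _ sF tH] [/= _ s'F t'H].
  (* Joining two index pairs may repeat entries; [undup] removes repetitions within each half, and
     disjointness of [F] and [H] excludes them across halves. *)
  exists (undup (s ++ s'), undup (t ++ t')); first split => /=.
  - rewrite cat_uniq !undup_uniq andbT /=.
    apply/hasPn => i; rewrite !mem_undup !mem_cat => it.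
    apply/negP => is_.
    have : (F `&` H) i.
      by split; [case/orP: is_ => [/sF|/s'F]|case/orP: it => [/tH|/t'H]].
    by rewrite FH0.
  - by move=> i /=; rewrite mem_undup mem_cat => /orP[/sF|/s'F].
  - by move=> i /=; rewrite mem_undup mem_cat => /orP[/tH|/t'H].
  move=> z [zs zt]; split; split.
  - by move=> i /= si; apply: zs => /=; rewrite mem_undup mem_cat si.
  - move=> [i /= ti Bi]; apply: zt; exists i => //=.
    by rewrite mem_undup mem_cat ti.
  - by move=> i /= si; apply: zs => /=; rewrite mem_undup mem_cat si orbT.
  - move=> [i /= ti Bi]; apply: zt; exists i => //=.
    by rewrite mem_undup mem_cat ti orbT.
have [z [_ zc]] := cT _ ED filterT.
exists z; split=> [i Fi|[i Hi Bi]].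
- apply: (clA _ Fi) => V Vz; apply: zc Vz.
  exists ([:: i], [::]).
    by split=> //= j /=; rewrite inE => /eqP ->.
  by move=> y [+ _]; apply; rewrite /= inE.
- have Biz : nbhs z (B i) by apply: open_nbhs_nbhs; split=> //; exact: opB.
  have [|y [yB By]] := zc (~` B i) _ _ Biz.
    exists ([::], [:: i]).
      by split=> //= j /=; rewrite inE => /eqP ->.
    by move=> y [_ yB] By; apply: yB; exists i; rewrite //= inE.
  exact: yB.
Qed.

(** * Compact convex sets of functions *)

Lemma compact_set_type (T : topologicalType) (K : set T) :
  compact K -> compact [set: set_type K].
Proof.
move=> cK F FF _.
have FK : (@set_val T K @ F) K.
  by apply: (@filterS _ F _ setT) filterT => z _; exact: set_valP.
have [p [Kp pc]] := cK _ _ FK.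
exists (exist _ p (mem_set Kp)); split=> // A V FA [_ [[W oW <-] Wp WV]].
have [||_ [[z Az <-] Wz]] := pc (@set_val T K @` A) W; last first.
  by exists z; split=> //; exact: WV.
- exact: open_nbhs_nbhs.
- by apply: (@filterS _ F _ A) FA => z Az; exists z.
Qed.

Lemma ptws_subtype_ext (R : realType) (Gamma : Type)
    (K : set {ptws Gamma -> R}) (f h : set_type K) :
  (forall g, set_val f g = set_val h g) -> f = h.
Proof. by move=> fh; apply: val_inj; apply/funext. Qed.

Lemma ptws_subtype_proj_continuous (R : realType) (Gamma : Type)
    (K : set {ptws Gamma -> R}) (g : Gamma) :
  continuous (fun f : set_type K => set_val f g : R).
Proof.
move=> f.
apply: (@continuous_comp _ _ _ set_val (fun h : {ptws Gamma -> R} => h g)).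
  exact: initial_continuous.
exact: (@proj_continuous {classic Gamma} (fun=> R) g).
Qed.

(** Otherwise the pairs (f, h) with f in [C], h outside [U] and uniform distance at most 1/(n+1)
    form decreasing nonempty closed sets in a compact square. A common pair would have f = h,
    against the inclusion of [C] in [U]. *)
Lemma compact_uniform_nbhs (R : realType) (Gamma : Type)
    (K : set {ptws Gamma -> R}) (C U : set (set_type K)) :
  compact K -> closed C -> open U -> C `<=` U ->
  exists n : nat, forall f h : set_type K, C f ->
    (forall g, `|set_val f g - set_val h g| <= n.+1%:R^-1) -> U h.
Proof.
move=> cK clC opU CU; apply: contrapT => /forallNP noN.
pose A n := [set p : set_type K * set_type K | [/\ C p.1, ~ U p.2 &
  forall g, `|set_val p.1 g - set_val p.2 g| <= n.+1%:R^-1]].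
(* The uniform bound is an intersection of one-coordinate bounds, so it is closed even in the
   pointwise topology. *)
have clA n : closed (A n).
  rewrite (_ : A n = (fst @^-1` C `&` snd @^-1` (~` U)) `&`
    \bigcap_g ((fun p => `|set_val p.1 g - set_val p.2 g|) @^-1`
      [set r | r <= n.+1%:R^-1])); last first.
    apply/seteqP; split=> p /=.
      by move=> [Cp Up d]; split=> // g _; exact: d.
    by move=> [[Cp Up] d]; split=> // g; exact: d g I.
  apply: closedI; first apply: closedI.
  - by apply: closed_comp (_ : closed C) => // p _; exact: cvg_fst.
  - by apply: closed_comp (open_closedC opU) => p _; exact: cvg_snd.
  apply: closed_bigI => g _.
  apply: closed_comp (@closed_le _ _) => p _.
  pose ev (f : set_type K) := set_val f g : R.
  have evc : continuous ev by exact: ptws_subtype_proj_continuous.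
  have cfst : continuous (fun q : set_type K * set_type K => set_val q.1 g).
    by move=> q; apply: (@continuous_comp _ _ _ fst ev);
      [exact: cvg_fst|exact: evc].
  have csnd : continuous (fun q : set_type K * set_type K => set_val q.2 g).
    by move=> q; apply: (@continuous_comp _ _ _ snd ev);
      [exact: cvg_snd|exact: evc].
  apply: cvg_norm; apply: cvgB; [exact: cfst|exact: csnd].
have cKK : compact [set: set_type K * set_type K].
  by rewrite -setXTT; apply: compact_setX; exact: compact_set_type.
have [//|s t _ _ tH|[f h] [fhA _]] := @compact_meet_minus_join _ nat A
    (fun=> set0) setT set0 cKK (setI0 _) (fun n _ => clA n).
(* The sets [A n] decrease, so a pair from the one of largest index in [s] lies in all of them. *)
- have /existsNP[f /existsNP[h /not_implyP[Cf /not_implyP[fh Uh]]]] :=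
    noN (\max_(i <- s) i).
  exists (f, h); split; last by move=> [i /tH].
  move=> i /= si; split=> // g; apply: le_trans (fh g) _.
  rewrite lef_pV2 ?posrE ?ltr0n // ler_nat ltnS.
  exact: (leq_bigmax_seq (F := id)).
- have [Cf Uh _] := fhA 0%N I.
  apply: Uh; suff <- : f = h by exact: CU.
  apply: ptws_subtype_ext => g; apply/eqP; rewrite -subr_eq0 -normr_le0.
  apply/ler_addgt0Pl => e e0; rewrite addr0.
  have [_ _ /(_ g) /= fhg] := fhA (Num.truncn e^-1) I.
  apply: le_trans fhg _; rewrite invf_ple ?posrE //.
  exact/ltW/truncnS_gt.
Qed.

(** Take f + i/(n+1) (f' - f): consecutive points differ by (f' - f)/(n+1), and the coordinates of
    f' - f are at most 1 in absolute value. *)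
Lemma convex_chain (R : realType) (Gamma : Type) (K : set {ptws Gamma -> R})
    (n : nat) (f f' : set_type K) :
  convex_set K -> (forall f, K f -> forall g, 0 <= f g <= 1) ->
  exists h : nat -> set_type K, [/\ h 0%N = f, h n.+1 = f' &
    forall i g, (i <= n)%N ->
      `|set_val (h i) g - set_val (h i.+1) g| <= n.+1%:R^-1].
Proof.
move=> cvxK cubeK.
have step (i : nat) : exists k : set_type K, (i <= n.+1)%N -> forall g,
    set_val k g = set_val f g + i%:R / n.+1%:R * (set_val f' g - set_val f g).
  (* Past n+1 the formula may leave [K]; [f] is a default value that makes [h] total. *)
  have [le_in|] := leqP i n.+1; last by exists f.
  have t01 : 0 <= (i%:R / n.+1%:R : R) <= 1.
    by rewrite divr_ge0//= ler_pdivrMr ?ltr0n// mul1r ler_nat.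
  pose t := Itv01 (andP t01).1 (andP t01).2.
  have := cvxK (set_val f') (set_val f) t (valP f') (valP f).
  move=> Kt; exists (exist (fun k => k \in K) _ Kt) => _ g.
  pose u : R := i%:R / n.+1%:R.
  transitivity (u * set_val f' g + (1 - u) * set_val f g) => //.
  by rewrite -/u mulrBl mul1r mulrBr addrCA.
have {step} [h hE] := choice step; exists h; split.
- by apply: ptws_subtype_ext => g; rewrite hE// mul0r mul0r addr0.
- apply: ptws_subtype_ext => g; rewrite hE// divff ?pnatr_eq0// mul1r.
  by rewrite addrC subrK.
move=> i g le_in; rewrite !hE//; last exact: leqW.
have -> (a b : R) : a + i%:R / n.+1%:R * b - (a + i.+1%:R / n.+1%:R * b) =
    n.+1%:R^-1 * - b by rewrite -natr1; field.
rewrite normrM normrN ger0_norm ?invr_ge0// ler_piMr ?invr_ge0//.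
have /andP[f0 f1] : 0 <= set_val f g <= 1 := cubeK _ (set_valP f) g.
have /andP[f'0 f'1] : 0 <= set_val f' g <= 1 := cubeK _ (set_valP f') g.
by rewrite ler_norml; apply/andP; split; lra.
Qed.

Lemma nat_crossing (P : nat -> Prop) (n : nat) :
  P 0%N -> ~ P n -> exists i, [/\ (i < n)%N, P i & ~ P i.+1].
Proof.
move=> P0; elim: n => [//|n IHn] Pn1.
have [Pn|/IHn[i [lt_in Pi Pi1]]] := pselect (P n); first by exists n.
by exists i; split=> //; exact: leqW.
Qed.

Lemma card_eq_II1 (T : Type) (A : set T) :
  (A #= `I_1)%card -> exists z, A = [set z].
Proof.
move=> /card_set_bijP[f [fA finj fsurj]]; have [z Az fz] := fsurj 0%N isT.
exists z; apply/seteqP; split=> [y Ay|_ -> //].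
apply: finj; rewrite ?inE// fz; have := fA _ Ay.
by rewrite /= ltnS leqn0 => /eqP.
Qed.

(** * Passing between points of [L] and points of [T] *)

Lemma pseudoclopen_iso_mem (L T : topologicalType) (G : set (set L))
    (P : set (set T * set T)) (phi : set L -> set T * set T) (a : set L) :
  pseudoclopen_iso G P phi -> G a -> pseudoclopen (phi a).
Proof. by move=> [+ [fG _ _] _ _] Ga; apply; exact: fG. Qed.

(** The point [x] witnesses that the finite intersections in [L] are nonempty, so the contrapositive
    of condition (2) makes those in [T] nonempty. *)
Lemma pseudoclopen_iso_point (L T : topologicalType) (G : set (set L))
    (P : set (set T * set T)) (phi : set L -> set T * set T) (x : L) :
  pseudoclopen_iso G P phi -> compact [set: T] ->
  exists f : T, forall a, G a ->
    (a x -> (phi a).1 f) /\ (~ a x -> ~ (phi a).2 f).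
Proof.
move=> isoGP cT; have [_ _ _ iso2] := isoGP.
have [||||f [fF fH]] := @compact_meet_minus_join T (set L)
  (fun a => (phi a).1) (fun a => (phi a).2)
  [set a | G a /\ a x] [set a | G a /\ ~ a x] cT.
- by apply/seteqP; split=> // a [[_ ax] []].
- by move=> a [/(pseudoclopen_iso_mem isoGP)[]].
- by move=> a [/(pseudoclopen_iso_mem isoGP)[]].
- move=> s t ust sF tH; apply/set0P/eqP => /(iso2 _ _ ust) st0.
  suff : meet_minus_join id id s t x.
    by rewrite st0// => a; rewrite /= mem_cat => /orP[/sF[]|/tH[]].
  by split=> [a /sF[]|[a /tH[]]].
by exists f => a Ga; split=> ax; [exact: fF|move=> af; apply: fH; exists a].
Qed.

(** Dually, [f] witnesses the finite intersections in [T], condition (1) carries this to [L], and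
    clopenness of the members of [G] allows the compactness argument there. *)
Lemma pseudoclopen_iso_meet (L T : topologicalType) (G : set (set L))
    (P : set (set T * set T)) (phi : set L -> set T * set T) (f : T)
    (F H : set (set L)) :
  pseudoclopen_iso G P phi -> compact [set: L] ->
  (forall a, G a -> clopen a) -> F `<=` G -> H `<=` G -> F `&` H = set0 ->
  (forall a, F a -> (phi a).2 f) -> (forall a, H a -> ~ (phi a).1 f) ->
  (\bigcap_(a in F) a) `\` (\bigcup_(a in H) a) !=set0.
Proof.
move=> [_ _ iso1 _] cL clopenG FG HG FH0 fF fH.
apply: compact_meet_minus_join => //.
- by move=> a /FG/clopenG[].
- by move=> a /HG/clopenG[].
move=> s t ust sF tH; apply/set0P/eqP => /(iso1 _ _ ust) st0.
suff : meet_minus_join (fun a => (phi a).2) (fun a => (phi a).1) s t f.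
  by rewrite st0// => a; rewrite /= mem_cat => /orP[/sF/FG|/tH/HG].
by split=> [a /sF/fF|[a /tH/fH]].
Qed.

Theorem theorem5p1 (R : realType) (Gamma : Type) (K : set {ptws Gamma -> R})
  (K_neq0 : K !=set0)
  (K_compact : compact K)
  (K_convex : convex_set K)
  (K_cube : forall f, K f -> forall g, 0 <= f g <= 1)
  (L : topologicalType)
  (L_neq0 : [set: L] !=set0)
  (L_compact : compact [set: L])
  (L_hausdorff : hausdorff_space L)
  (L_zero_dim : basis [set U : set L | clopen U])
  (G : set (set L))
  (G_clopen : forall a, G a -> clopen a)
  (G_iso : pseudoclopen_isomorphic (set_type K) G) :
  exists Gn : nat -> set (set L),
    G = \bigcup_n Gn n /\
    forall (x y : L) (n : nat), exists Gnm : nat -> set (set L),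
      Gn n = \bigcup_(m in [set m | (m <= n)%N]) Gnm m /\
      forall m : nat, (m <= n)%N ->
        (forall F H : set (set L),
          Gnm m = F `|` H -> F `&` H = set0 ->
          [set a | [/\ Gnm m a, a x & a y]] `<=` F ->
          [set a | [/\ Gnm m a, ~ a x & ~ a y]] `<=` H ->
          (\bigcap_(a in F) a) `\` (\bigcup_(a in H) a) !=set0) /\
        (x <> y ->
          independent [set a | Gnm m a /\ (a `&` [set x; y] #= `I_1)%card]).
Proof.
have [P [phi iso]] := G_iso.
have cK := compact_set_type K_compact.
pose Gn n := [set a | G a /\ forall f h : set_type K, (phi a).1 f ->
  (forall g, `|set_val f g - set_val h g| <= n.+1%:R^-1) -> (phi a).2 h].
exists Gn; split.
  apply/seteqP; split=> [a Ga|a [n _ []//]].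
  have [cl1 op2 sub12] := pseudoclopen_iso_mem iso Ga.
  by have [n] := compact_uniform_nbhs K_compact cl1 op2 sub12; exists n.
move=> x y n.
have [fx fxP] := pseudoclopen_iso_point x iso cK.
have [fy fyP] := pseudoclopen_iso_point y iso cK.
have [h [h0 hn hstep]] := convex_chain n fx fy K_convex K_cube.
(* A set separating x from y meets both premises, so [h m] lies in a^+ minus a^- and the set may go
   into either [F] or [H]. Sets containing both points, or neither, face one requirement only. The
   pieces may overlap. *)
pose Gnm m := [set a | [/\ Gn n a, a x \/ a y -> (phi a).2 (h m) &
  ~ a x \/ ~ a y -> ~ (phi a).1 (h m)]].
exists Gnm; split.
  apply/seteqP; split=> [a Gna|a [m _ []//]].
  have [Ga near_a] := Gna.
  have [_ _ sub12] := pseudoclopen_iso_mem iso Ga.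
  have [fx1 fx2] := fxP _ Ga; have [fy1 fy2] := fyP _ Ga.
  have [ax|nax] := pselect (a x); have [ay|nay] := pselect (a y).
  - exists 0%N => //; split=> //; last by case.
    by move=> _; rewrite h0; exact/sub12/fx1.
  (* The chain leaves a^- between i and i+1, and the first point outside is still in a^+. Its index
     is at most n because [h n.+1] is [fy], outside a^+. *)
  - have [||i [lt_in hi hi1]] := @nat_crossing (fun i => (phi a).1 (h i)) n.+1.
    + by rewrite h0; exact: fx1.
    + by rewrite hn => /sub12; exact: fy2.
    have h2 : (phi a).2 (h i.+1) by apply: near_a hi _ => g; exact: hstep.
    exists i.+1 => //=; rewrite ltn_neqAle -ltnS lt_in andbT.
    by apply: contra_notN (fy2 nay) => /eqP ein; rewrite -hn -ein.
  (* Here the chain enters a^-, so the point just before entry is chosen; its index is at most n at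
     once. *)
  - have [||i [lt_in hi hi1]] :=
      @nat_crossing (fun i => ~ (phi a).1 (h i)) n.+1.
    + by rewrite h0 => /sub12; exact: fx2.
    + by rewrite hn; apply; exact: fy1.
    exists i => //; split=> // _; apply: near_a (contrapT hi1) _ => g.
    by rewrite distrC; exact: hstep.
  - exists 0%N => //; split=> //; first by case.
    by move=> _; rewrite h0 => /sub12; exact: fx2.
move=> m _.
have meet (F H : set (set L)) : Gnm m = F `|` H -> F `&` H = set0 ->
    [set a | [/\ Gnm m a, a x & a y]] `<=` F ->
    [set a | [/\ Gnm m a, ~ a x & ~ a y]] `<=` H ->
    (\bigcap_(a in F) a) `\` (\bigcup_(a in H) a) !=set0.
  move=> GFH FH0 bothF noneH.
  have FGnm : F `<=` Gnm m by rewrite GFH; exact: subsetUl.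
  have HGnm : H `<=` Gnm m by rewrite GFH; exact: subsetUr.
  have FHN a : F a -> H a -> False.
    by move=> Fa Ha; have : (F `&` H) a by []; rewrite FH0.
  apply: (pseudoclopen_iso_meet (f := h m) iso) => //.
  - by move=> a /FGnm[[]].
  - by move=> a /HGnm[[]].
  - move=> a Fa; have Ga := FGnm _ Fa; have [_ + _] := Ga; apply.
    apply: contrapT => /not_orP[nax nay]; apply: (FHN a) => //.
    exact: noneH.
  - move=> a Ha; have Ga := HGnm _ Ha; have [_ _] := Ga; apply.
    apply: contrapT => /not_orP[/contrapT ax /contrapT ay].
    by apply: (FHN a) => //; exact: bothF.
split=> // neq_xy s t ust stG.
(* As x and y are distinct, a one-point trace means that [a] separates them. *)
have card1 a : (a `&` [set x; y] #= `I_1)%card ->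
    ~ (a x /\ a y) /\ ~ (~ a x /\ ~ a y).
  move=> /card_eq_II1[z az]; split=> [[ax ay]|[nax nay]].
    apply: neq_xy.
    have xz : [set z] x by rewrite -az; split=> //; left.
    have yz : [set z] y by rewrite -az; split=> //; right.
    by rewrite xz yz.
  have [] : (a `&` [set x; y]) z by rewrite az.
  by move=> + [zx|zy]; rewrite ?zx ?zy.
have memst a : a \in s \/ a \in t -> Gnm m a /\ (a `&` [set x; y] #= `I_1)%card.
  by move=> /orP ast; apply: stG; rewrite /= mem_cat.
(* The lists extend to a partition of all of [Gnm m]: sets in [s] or containing both points go to
   [F], and the rest, which includes [t], to its complement. *)
pose F := [set a | Gnm m a /\ (a \in s \/ (a x /\ a y))].
have [||a []|a [] Ga nax nay|z [zF zH]] := meet F (Gnm m `\` F).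
- by rewrite setUDr setDv setD0 setUC; apply/esym/setUidPl => a [].
- by apply/seteqP; split=> // a [Fa [_]].
- by split=> //; right.
- split=> // -[_ [sa|[]//]].
  by have [_ /card1[_]] := memst _ (or_introl sa); apply.
exists z; split=> [a /= sa|[a /= ta az]].
  by have [Ga _] := memst _ (or_introl sa); apply: zF; split; last left.
have [Ga /card1[nboth _]] := memst _ (or_intror ta).
apply: zH; exists a => //; split=> // -[_ [sa|//]].
by move: ust; rewrite cat_uniq => /and3P[_ /hasPn/(_ _ ta)]; rewrite /= sa.
Qed.
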